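(* Let $g,\gamma\in\mathbb{C}^N$, and let $\mu=\max_{\ell\in\{0,\dots,N-1\}}\max_{i\in\{1,\dots,N\}}|\chi_\ell(i)|$. If $$|\hat g(0)+\hat\gamma(0)|>\sqrt N\,\mu\,\|\hat g-\hat\gamma\|_2,$$ then $\langle T_ng,T_n\gamma\rangle\neq 0$ for all $n=1,\dots,N$.
   Context: Let $G=(V,E)$ be a finite, connected, undirected, weighted simple graph with vertex set $V=\{1,\dots,N\}$, and let $W=(W_{ij})$ be its weighted adjacency matrix: real, symmetric, zero diagonal, $W_{ij}\ge 0$, with $W_{ij}\neq0$ exactly when $i,j$ are adjacent. Let $D=\operatorname{diag}(d_1,\dots,d_N)$ with $d_i=\sum_{j}W_{ij}$, and let $\mathcal{L}=D-W$ be the graph Laplacian. Fix an orthonormal basis $(\chi_0,\dots,\chi_{N-1})$ of $\mathbb{C}^N$ consisting of eigenvectors of $\mathcal{L}$, ordered so that the eigenvalues satisfy $0=\lambda_0<\lambda_1\le\dots\le\lambda_{N-1}$ (so $|\chi_0(i)|=1/\sqrt N$ for all $i$). Signals are vectors $f=(f(1),\dots,f(N))\in\mathbb{C}^N$; the inner product $\langle f,h\rangle=\sum_{i=1}^N f(i)\overline{h(i)}$ is conjugate-linear in the second argument, and $\|\cdot\|_2$ is the Euclidean norm on $\mathbb{C}^N$. Graph Fourier transform: $\hat f(\ell)=\langle f,\chi_\ell\rangle$, $\ell=0,\dots,N-1$, with $\hat f$ regarded as a vector in $\mathbb{C}^N$. Generalized translation, for $n\in\{1,\dots,N\}$: $(T_nf)(i)=\sqrt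 N\sum_{\ell=0}^{N-1}\hat f(\ell)\overline{\chi_\ell(n)}\chi_\ell(i)$. *)

(* Defs.v *)
From mathcomp Require Import all_boot all_order all_algebra.
From mathcomp Require Import reals complex.

Set Implicit Arguments.
Unset Strict Implicit.
Unset Printing Implicit Defensive.

Import Order.TTheory GRing.Theory Num.Theory ComplexField.Normc.
Local Open Scope ring_scope.
Local Open Scope complex_scope.

(* Both the vertices 1, ..., N and the spectral indices 0, ..., N-1 are
   elements of 'I_N; vertex i of the usual numbering has index i - 1. *)

Record weighted_graph (R : realType) (N : nat) (adj : rel 'I_N) (W : 'M[R]_N) :
    Prop := WeightedGraph {
  adj_sym : symmetric adj;
  adj_irr : irreflexive adj;
  adj_connected : forall i j, connect adj i j;
  weight_sym : W^T = W;
  weight_diag : forall i, W i i = 0;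
  weight_ge0 : forall i j, 0 <= W i j;
  weight_adj : forall i j, (W i j != 0) = adj i j }.

Definition degree_mx (R : realType) (N : nat) (W : 'M[R]_N) : 'M[R]_N :=
  diag_mx (\row_i \sum_j W i j).

Definition laplacian (R : realType) (N : nat) (W : 'M[R]_N) : 'M[R]_N :=
  degree_mx W - W.

Definition inner (R : realType) (N : nat) (f h : 'cV[R[i]]_N) : R[i] :=
  \sum_i f i 0 * (h i 0)^*%R.

(* normc is the modulus with values in R, whereas `|z| is its image in R[i]. *)
Definition norm2 (R : realType) (N : nat) (f : 'cV[R[i]]_N) : R :=
  Num.sqrt (\sum_i normc (f i 0) ^+ 2).

(* The real matrix laplacian W acts on C^N via the embedding of R in R[i]. *)
Record laplacian_eigenbasis (R : realType) (N : nat) (W : 'M[R]_N)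
    (chi : 'I_N -> 'cV[R[i]]_N) (lambda : 'I_N -> R) : Prop :=
    LaplacianEigenbasis {
  eigen_basis : basis_of fullv [tuple chi l | l < N];
  eigen_orthonormal : forall k l, inner (chi k) (chi l) = (k == l)%:R;
  eigen_eq : forall l,
    map_mx (real_complex R) (laplacian W) *m chi l = (lambda l)%:C *: chi l;
  eigen_val0 : forall l : 'I_N, l = 0%N :> nat -> lambda l = 0;
  eigen_val_gt0 : forall l : 'I_N, (0 < l)%N -> 0 < lambda l;
  eigen_val_mono : forall k l : 'I_N, (k <= l)%N -> lambda k <= lambda l }.

Definition gft (R : realType) (N : nat) (chi : 'I_N -> 'cV[R[i]]_N)
    (f : 'cV[R[i]]_N) : 'cV[R[i]]_N :=
  \col_l inner f (chi l).

Definition translation (R : realType) (N : nat) (chi : 'I_N -> 'cV[R[i]]_N)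
    (n : 'I_N) (f : 'cV[R[i]]_N) : 'cV[R[i]]_N :=
  \col_i ((Num.sqrt N%:R)%:C *
          \sum_l gft chi f l 0 * (chi l n 0)^*%R * chi l i 0).

(* All the moduli are nonnegative, so the default value 0 of the iterated
   maximum does not affect it. *)
Definition coherence (R : realType) (N : nat) (chi : 'I_N -> 'cV[R[i]]_N) : R :=
  \big[Num.max/0]_l \big[Num.max/0]_i normc (chi l i 0).

(* Main.v *)
Require Import Defs.
From mathcomp Require Import all_boot all_order all_algebra.
From mathcomp Require Import reals complex.
From mathcomp Require Import ring.

(** Write [a l = gft g l * conj (chi l n)] and [b l = gft gamma l * conj (chi l n)].
    Up to the factor [sqrt N], these are the coordinates of the two translates
    in the orthonormal family [chi], so [<T_n g, T_n gamma>] is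
    [N * \sum_l a l * conj (b l)] ([inner_translation]).  If it vanishes, [a]
    and [b] are orthogonal, and the two diagonals of the rectangle that they
    span have the same length: [|a + b| = |a - b|] ([rectangle_diagonals]).

    On one side, [|a - b|^2] is at most [mu^2 * |gft g - gft gamma|^2], since
    every [chi l n] has modulus at most [mu].  On the other side, [|a + b|^2]
    is at least its term of index [0], namely
    [|gft g 0 + gft gamma 0|^2 / N], because [chi 0] has constant modulus
    [1 / sqrt N] ([normsq_ground_state]).  Together these bounds contradict
    the hypothesis.

    That [chi 0] is flat comes from the positivity of the other eigenvalues:
    the columns of the Laplacian sum to zero, so the all-ones vector is
    orthogonal to every [chi l] with [l > 0] and hence is a multiple of
    [chi 0]. *)

Set Implicit Arguments.
Unset Strict Implicit.
Unset Printing Implicit Defensive.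

Import Order.TTheory GRing.Theory Num.Theory ComplexField.Normc.
Local Open Scope ring_scope.
Local Open Scope complex_scope.

(** The two sides differ by [2 (<a, b> + <b, a>)], and the second inner product
    is the conjugate of the first. *)
Lemma rectangle_diagonals (C : numClosedFieldType) (I : finType) (a b : I -> C) :
    \sum_i a i * (b i)^*%R = 0 ->
  \sum_i `|a i + b i| ^+ 2 = \sum_i `|a i - b i| ^+ 2.
Proof.
move=> ab0.
have ba0 : \sum_i b i * (a i)^*%R = 0.
  rewrite -[RHS](rmorph0 (@Num.conj C)) -[in RHS]ab0 rmorph_sum /=.
  by apply: eq_bigr => i _; rewrite rmorphM /= conjCK mulrC.
apply/eqP; rewrite -subr_eq0 -sumrB; apply/eqP.
transitivity (2 * (\sum_i a i * (b i)^*%R + \sum_i b i * (a i)^*%R)); last first.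
  by rewrite ab0 ba0 addr0 mulr0.
rewrite -big_split mulr_sumr; apply: eq_bigr => i _ /=.
rewrite !normCK rmorphB rmorphD /= !mulrDl !mulrDr !mulNr !mulrN.
by ring.
Qed.

Section OrthonormalFamily.

Variables (R : realType) (N : nat) (chi : 'I_N -> 'cV[R[i]]_N).
Hypothesis chi_on : forall k l, inner (chi k) (chi l) = (k == l)%:R.

(** The matrix with rows [chi l] is unitary: its adjoint is a right inverse,
    hence also a left inverse. *)
Lemma orthonormal_completeness (i j : 'I_N) :
  \sum_l (chi l i 0)^*%R * chi l j 0 = (i == j)%:R.
Proof.
pose U : 'M[R[i]]_N := \matrix_(l, k) chi l k 0.
pose V : 'M[R[i]]_N := \matrix_(k, l) (chi l k 0)^*%R.
have UV : U *m V = 1%:M.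
  apply/matrixP => k l; rewrite !mxE -chi_on.
  by apply: eq_bigr => m _; rewrite !mxE.
have /matrixP/(_ i j) := mulmx1C UV; rewrite !mxE => <-.
by apply: eq_bigr => l _; rewrite !mxE.
Qed.

Lemma inner_orthonormal_sum (a b : 'I_N -> R[i]) :
  inner (\col_i \sum_l a l * chi l i 0) (\col_i \sum_l b l * chi l i 0)
  = \sum_l a l * (b l)^*%R.
Proof.
rewrite /inner.
transitivity (\sum_k \sum_l a k * (b l)^*%R * inner (chi k) (chi l)).
  under eq_bigr => i _.
    rewrite !mxE rmorph_sum mulr_suml.
    under eq_bigr do rewrite mulr_sumr.
    over.
  rewrite exchange_big; apply: eq_bigr => k _.
  rewrite exchange_big; apply: eq_bigr => l _.
  rewrite /inner mulr_sumr; apply: eq_bigr => i _.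
  by rewrite rmorphM /= mulrACA.
apply: eq_bigr => k _; rewrite (bigD1 k) //= chi_on eqxx mulr1.
rewrite big1 ?addr0 // => l /negbTE lk.
by rewrite chi_on eq_sym lk mulr0.
Qed.

Lemma inner_translation (n : 'I_N) (f h : 'cV[R[i]]_N) :
  inner (translation chi n f) (translation chi n h)
  = N%:R * \sum_l (gft chi f l 0 * (chi l n 0)^*%R)
                  * (gft chi h l 0 * (chi l n 0)^*%R)^*%R.
Proof.
rewrite -inner_orthonormal_sum /inner mulr_sumr.
apply: eq_bigr => i _; rewrite /translation !mxE rmorphM /= mulrACA.
congr (_ * _); rewrite -normCK normc_def /= expr0n addr0.
by rewrite sqrtr_sqr -rmorphXn real_normK ?num_real // sqr_sqrtr ?ler0n //= rmorph_nat.
Qed.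

End OrthonormalFamily.

Lemma laplacian_col_sum (R : realType) (N : nat) (W : 'M[R]_N) (j : 'I_N) :
  W^T = W -> \sum_i laplacian W i j = 0.
Proof.
move=> Wsym; rewrite /laplacian /degree_mx.
under eq_bigr do rewrite !mxE.
rewrite sumrB (bigD1 j) //= eqxx mulr1n [X in _ + X - _]big1 ?addr0; last first.
  by move=> i /negbTE ->; rewrite mulr0n.
apply/eqP; rewrite subr_eq0; apply/eqP; apply: eq_bigr => i _.
by rewrite -{1}Wsym mxE.
Qed.

(** Summing the entries of [L v = lam v] gives [0 = lam * \sum_i v i], as the
    columns of [L] sum to zero. *)
Lemma sum_eigenvector (R : realType) (N : nat) (W : 'M[R]_N) (lam : R)
    (v : 'cV[R[i]]_N) :
    W^T = W -> lam != 0 ->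
    map_mx (real_complex R) (laplacian W) *m v = lam%:C *: v ->
  \sum_i v i 0 = 0.
Proof.
move=> Wsym lam0 Lv.
have : lam%:C * \sum_i v i 0 = 0.
  rewrite mulr_sumr.
  transitivity (\sum_i (map_mx (real_complex R) (laplacian W) *m v) i 0).
    by rewrite Lv; apply: eq_bigr => i _; rewrite mxE.
  under eq_bigr do rewrite mxE.
  rewrite exchange_big big1 // => j _.
  rewrite -mulr_suml; under eq_bigr do rewrite mxE.
  by rewrite -rmorph_sum laplacian_col_sum // rmorph0 mul0r.
by move/eqP; rewrite mulf_eq0 fmorph_eq0 (negbTE lam0) => /eqP.
Qed.

(** Expanding the all-ones vector in the basis leaves only its component along
    [chi 0], so [chi 0] is constant, and its norm is 1. *)
Lemma normsq_ground_state (R : realType) (N : nat) (N_gt0 : (0 < N)%N)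
    (W : 'M[R]_N) (chi : 'I_N -> 'cV[R[i]]_N) (lambda : 'I_N -> R) (n : 'I_N) :
    W^T = W -> laplacian_eigenbasis W chi lambda ->
  N%:R * `|chi (Ordinal N_gt0) n 0| ^+ 2 = 1.
Proof.
move=> Wsym [_ on eig _ pos _]; set o := Ordinal N_gt0.
pose S := \sum_i chi o i 0.
have S1 m : (chi o m 0)^*%R * S = 1.
  transitivity (\sum_i (m == i)%:R : R[i]); last first.
    rewrite (bigD1 m) //= eqxx big1 ?addr0 // => i /negbTE im.
    by rewrite eq_sym im.
  under [RHS]eq_bigr do rewrite -(orthonormal_completeness on).
  rewrite exchange_big (bigD1 o) //= -mulr_sumr [X in _ + X]big1 ?addr0 // => l lo.
  rewrite -mulr_sumr (sum_eigenvector Wsym _ (eig l)) ?mulr0 //.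
  by rewrite gt_eqF // pos // lt0n; apply: contra lo => /eqP l0; apply/eqP/val_inj.
have S0 : S != 0.
  by apply/eqP => S0; have /eqP := S1 n; rewrite S0 mulr0 eq_sym oner_eq0.
have flat m : chi o m 0 = chi o n 0.
  by apply/(can_inj conjCK)/(mulIf S0); rewrite !S1.
have := on o o; rewrite eqxx /inner.
under eq_bigr do rewrite flat -normCK.
by rewrite sumr_const card_ord mulr_natl.
Qed.

Lemma normc_le_coherence (R : realType) (N : nat) (chi : 'I_N -> 'cV[R[i]]_N)
    (l i : 'I_N) :
  normc (chi l i 0) <= coherence chi.
Proof.
apply: le_trans (le_bigmax _ _ l).
exact: (le_bigmax _ (fun i => normc (chi l i 0))).
Qed.

Lemma normc_ge0 (R : rcfType) (z : R[i]) : 0 <= normc z.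
Proof. by case: z => x y; exact: sqrtr_ge0. Qed.

Theorem lemma3p9 (R : realType) (N : nat) (N_gt0 : (0 < N)%N)
    (adj : rel 'I_N) (W : 'M[R]_N) (graphW : weighted_graph adj W)
    (chi : 'I_N -> 'cV[R[i]]_N) (lambda : 'I_N -> R)
    (chi_basis : laplacian_eigenbasis W chi lambda)
    (g gamma : 'cV[R[i]]_N)
    (hg : Num.sqrt N%:R * coherence chi * norm2 (gft chi g - gft chi gamma)
          < normc (gft chi g (Ordinal N_gt0) 0
                   + gft chi gamma (Ordinal N_gt0) 0)) :
  forall n : 'I_N, inner (translation chi n g) (translation chi n gamma) != 0.
Proof.
move=> n; apply/negP; rewrite (inner_translation (eigen_orthonormal chi_basis)).
rewrite mulf_eq0 pnatr_eq0 eqn0Ngt N_gt0 /= => /eqP/rectangle_diagonals.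
under eq_bigr do rewrite -mulrDl normrM norm_conjC exprMn.
under [RHS]eq_bigr do rewrite -mulrBl normrM norm_conjC exprMn.
set G := gft chi g in hg *; set H := gft chi gamma in hg *.
set o := Ordinal N_gt0 in hg; move=> diag.
have mu_ge0 : 0 <= coherence chi.
  exact: le_trans (normc_ge0 _) (normc_le_coherence chi n n).
have normC_normc (z : R[i]) : (normc z)%:C = `|z| by [].
have upper : \sum_l `|G l 0 - H l 0| ^+ 2 * `|chi l n 0| ^+ 2
             <= (coherence chi ^+ 2 * norm2 (G - H) ^+ 2)%:C.
  rewrite sqr_sqrtr ?sumr_ge0 // => [|l _]; last exact: sqr_ge0.
  rewrite mulr_sumr rmorph_sum; apply: ler_sum => l _ /=.
  rewrite !mxE -!normC_normc -!rmorphXn -rmorphM lecR /= mulrC.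
  by rewrite ler_wpM2r ?sqr_ge0 // lerXn2r ?nnegrE ?normc_ge0 ?normc_le_coherence.
have lower : `|G o 0 + H o 0| ^+ 2
             <= N%:R * \sum_l `|G l 0 + H l 0| ^+ 2 * `|chi l n 0| ^+ 2.
  rewrite (bigD1 o) //= mulrDr mulrCA.
  rewrite (normsq_ground_state N_gt0 n (weight_sym graphW) chi_basis) mulr1.
  by rewrite lerDl mulr_ge0 ?ler0n ?sumr_ge0 // => l _; rewrite mulr_ge0 ?exprn_ge0.
have : `|G o 0 + H o 0| ^+ 2
       <= N%:R * (coherence chi ^+ 2 * norm2 (G - H) ^+ 2)%:C.
  by apply: le_trans lower _; rewrite diag ler_wpM2l ?ler0n.
rewrite -normC_normc -rmorphXn -(rmorph_nat (real_complex R)) -rmorphM lecR /=.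
apply/negP; rewrite -ltNge mulrA -[N%:R]sqr_sqrtr ?ler0n // -!exprMn.
by rewrite ltrXn2r ?nnegrE ?normc_ge0 ?mulr_ge0 ?sqrtr_ge0.
Qed.
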